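(* Fix $k,l,m,n\in\mathbb{N}$ with $k\le m$, $l\le n$, and $k,l$ even. For every set $\Gamma$ of formulas of $\mathcal{L}_{\mathsf{MBCL}}$ and every formula $A$: if $\Gamma\vdash_{Ax_{\mathsf{MBCL}}^{k,l,m,n}}A$, then $\Gamma\vDash_{\mathbf{F}^{k,l,m,n}}A$.
   Context: $\mathcal{L}_{\mathsf{MBCL}}$ has variables $p_0,p_1,\dots$ (set $\mathrm{Var}$), unary $\neg,\Box,\Diamond$, binary $\wedge,\vee,\rightarrow$; $\mathrm{For}$ its formulas. $A\supset B:=\neg A\vee B$, $A\equiv B:=(\neg A\vee B)\wedge(\neg B\vee A)$; $\neg^jA$ is $A$ preceded by $j$ negations. A model is $\langle W,Q,\{R_w\}_{w\in W},v\rangle$ with $W\neq\emptyset$, $Q\subseteq W\times W$, $R_w\subseteq\mathrm{For}\times\mathrm{For}$ for each $w$, $v:W\times\mathrm{Var}\to\{0,1\}$; the triple $\langle W,Q,\{R_w\}\rangle$ is its frame. Truth at $w$: $p$ iff $v(w,p)=1$; $\neg,\wedge,\vee$ classical at $w$; $\Box B$ iff $B$ true at every $u$ with $Q(w,u)$; $\Diamond B$ iff $B$ true at some $u$ with $Q(w,u)$; $B\rightarrow C$ iff ($B$ false at $w$ or $C$ true at $w$) and $R_w(B,C)$. Conditions on a relation $R$ (for all $A,B$): (a1) not $R(A,\neg A)$; (a2) not $R(\neg A,A)$; (b0) $R(A,B)\Rightarrow$ not $R(A,\neg B)$; (b1) $R(A\rightarrow B,\neg(A\rightarrow\neg B))$;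 (b2) $R(A\rightarrow\neg B,\neg(A\rightarrow B))$; (cun) $R(A,B)\Rightarrow R(\neg A,\neg B)$; (cun$^{k,l,m,n}$) $R(\neg^kA,\neg^lB)\Rightarrow R(\neg^mA,\neg^nB)$. $\mathbf{F}^{k,l,m,n}$ is the class of frames in which every $R_w$ satisfies all these conditions. $\Gamma\vDash_{\mathbf{F}^{k,l,m,n}}A$: for every model on a frame in $\mathbf{F}^{k,l,m,n}$ and every world $w$, if all members of $\Gamma$ are true at $w$ then $A$ is true at $w$. $Ax_{\mathsf{MBCL}}^{k,l,m,n}$ has axiom schemata: (CPL) substitution instances of classical tautologies; $\neg(A\rightarrow\neg A)$; $\neg(\neg A\rightarrow A)$; $(A\rightarrow B)\rightarrow\neg(A\rightarrow\neg B)$; $(A\rightarrow\neg B)\rightarrow\neg(A\rightarrow B)$; $(A\rightarrow B)\supset(A\supset B)$; $(A\rightarrow B)\supset((\neg A\rightarrow\neg B)\vee(\neg A\wedge B))$; $(A\rightarrow B)\supset(\neg\neg A\rightarrow\neg\neg B)$; $(\neg^kA\rightarrow\neg^lB)\supset((\neg^mA\rightarrow\neg^nB)\vee(\neg^mA\wedge\neg^{n+1}B))$; $(\neg^kA\rightarrow\neg^lB)\supset(\neg^{2m-k}A\rightarrow\neg^{2n-l}B)$; (Dual) $\Diamond A\equiv\neg\Box\neg A$; (K$^\supset$) $\Box(A\supset B)\supset(\Box A\supset\Box B)$; rules: from $A$ and $A\supset B$ infer $B$; from a theorem $A$ infer $\Box A$ (necessitation applies only to theorems). $\Gamma\vdash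 A$: $A$ is derivable from theorems and members of $\Gamma$ using the first rule. *)

(* Defs.v *)
From Stdlib Require Import Arith.

Definition var := nat.

Inductive form : Type :=
| Var (p : var)
| Neg (A : form)
| Box (A : form)
| Dia (A : form)
| And (A B : form)
| Or (A B : form)
| Imp (A B : form).

Declare Scope mbcl_scope.
Delimit Scope mbcl_scope with mbcl.
Bind Scope mbcl_scope with form.

Notation "¬ A" := (Neg A) (at level 35, right associativity) : mbcl_scope.
Notation "□ A" := (Box A) (at level 35, right associativity) : mbcl_scope.
Notation "◇ A" := (Dia A) (at level 35, right associativity) : mbcl_scope.
Notation "A ∧ B" := (And A B) (at level 40, left associativity) : mbcl_scope.
Notation "A ∨ B" := (Or A B) (at level 50, left associativity) : mbcl_scope.
Notation "A ⇾ B" := (Imp A B) (at level 55, right associativity) : mbcl_scope.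

Definition material (A B : form) : form := (¬ A ∨ B)%mbcl.
Notation "A ⊃ B" := (material A B) (at level 60, right associativity) : mbcl_scope.

Definition equiv (A B : form) : form := ((¬ A ∨ B) ∧ (¬ B ∨ A))%mbcl.
Notation "A ≡ B" := (equiv A B) (at level 65, no associativity) : mbcl_scope.

Definition negs (j : nat) (A : form) : form := Nat.iter j Neg A.
Notation "¬^ j A" := (negs j A)
  (at level 35, j at level 9, A at level 35) : mbcl_scope.

Local Open Scope mbcl_scope.

Record frame : Type := Frame {
  world : Type;
  world_nonempty : inhabited world;
  Q : world -> world -> Prop;
  R : world -> form -> form -> Prop
}.

Definition valuation (F : frame) : Type := world F -> var -> bool.

Fixpoint truth (F : frame) (v : valuation F) (w : world F) (A : form) : Prop :=
  match A with
  | Var p => v w p = true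
  | Neg B => ~ truth F v w B
  | Box B => forall u : world F, Q F w u -> truth F v u B
  | Dia B => exists u : world F, Q F w u /\ truth F v u B
  | And B C => truth F v w B /\ truth F v w C
  | Or B C => truth F v w B \/ truth F v w C
  | Imp B C => (~ truth F v w B \/ truth F v w C) /\ R F w B C
  end.

Record rel_conditions (k l m n : nat) (S : form -> form -> Prop) : Prop := {
  cond_a1 : forall A, ~ S A (¬ A);
  cond_a2 : forall A, ~ S (¬ A) A;
  cond_b0 : forall A B, S A B -> ~ S A (¬ B);
  cond_b1 : forall A B, S (A ⇾ B) (¬ (A ⇾ ¬ B));
  cond_b2 : forall A B, S (A ⇾ ¬ B) (¬ (A ⇾ B));
  cond_cun : forall A B, S A B -> S (¬ A) (¬ B);
  cond_cun_klmn : forall A B, S (¬^k A) (¬^l B) -> S (¬^m A) (¬^n B)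
}.

Definition frame_class (k l m n : nat) (F : frame) : Prop :=
  forall w : world F, rel_conditions k l m n (R F w).

Definition entails (k l m n : nat) (Gamma : form -> Prop) (A : form) : Prop :=
  forall (F : frame) (v : valuation F) (w : world F),
    frame_class k l m n F ->
    (forall B : form, Gamma B -> truth F v w B) ->
    truth F v w A.

(* The classical language has the primitive connectives that are classical in
   the modal one; material implication and equivalence are abbreviations. *)
Inductive cform : Type :=
| CVar (p : var)
| CNeg (a : cform)
| CAnd (a b : cform)
| COr (a b : cform).

Fixpoint ceval (e : var -> bool) (a : cform) : bool :=
  match a with
  | CVar p => e p
  | CNeg a => negb (ceval e a)
  | CAnd a b => andb (ceval e a) (ceval e b)
  | COr a b => orb (ceval e a) (ceval e b)
  end.

Definition tautology (a : cform) : Prop :=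
  forall e : var -> bool, ceval e a = true.

Fixpoint csubst (s : var -> form) (a : cform) : form :=
  match a with
  | CVar p => s p
  | CNeg a => ¬ csubst s a
  | CAnd a b => csubst s a ∧ csubst s b
  | COr a b => csubst s a ∨ csubst s b
  end.

(* In [ax_klmn_double], subtraction on [nat] is truncated; it is the genuine
   difference when [k <= m] and [l <= n]. *)
Inductive axiom (k l m n : nat) : form -> Prop :=
| ax_CPL a s : tautology a -> axiom k l m n (csubst s a)
| ax_A1 A : axiom k l m n (¬ (A ⇾ ¬ A))
| ax_A2 A : axiom k l m n (¬ (¬ A ⇾ A))
| ax_B1 A B : axiom k l m n ((A ⇾ B) ⇾ ¬ (A ⇾ ¬ B))
| ax_B2 A B : axiom k l m n ((A ⇾ ¬ B) ⇾ ¬ (A ⇾ B))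
| ax_material A B : axiom k l m n ((A ⇾ B) ⊃ (A ⊃ B))
| ax_cun A B :
    axiom k l m n ((A ⇾ B) ⊃ ((¬ A ⇾ ¬ B) ∨ (¬ A ∧ B)))
| ax_cun_double A B :
    axiom k l m n ((A ⇾ B) ⊃ (¬ ¬ A ⇾ ¬ ¬ B))
| ax_klmn A B :
    axiom k l m n
      ((¬^k A ⇾ ¬^l B) ⊃ ((¬^m A ⇾ ¬^n B) ∨ (¬^m A ∧ ¬^(n + 1) B)))
| ax_klmn_double A B :
    axiom k l m n
      ((¬^k A ⇾ ¬^l B) ⊃ (¬^(2 * m - k) A ⇾ ¬^(2 * n - l) B))
| ax_Dual A : axiom k l m n (◇ A ≡ ¬ □ ¬ A)
| ax_K A B : axiom k l m n (□ (A ⊃ B) ⊃ (□ A ⊃ □ B)).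

Inductive thm (k l m n : nat) : form -> Prop :=
| thm_axiom A : axiom k l m n A -> thm k l m n A
| thm_mp A B : thm k l m n A -> thm k l m n (A ⊃ B) -> thm k l m n B
| thm_nec A : thm k l m n A -> thm k l m n (□ A).

Inductive derives (k l m n : nat) (Gamma : form -> Prop) : form -> Prop :=
| derives_thm A : thm k l m n A -> derives k l m n Gamma A
| derives_mem A : Gamma A -> derives k l m n Gamma A
| derives_mp A B :
    derives k l m n Gamma A -> derives k l m n Gamma (A ⊃ B) ->
    derives k l m n Gamma B.

(* Main.v *)
Require Import Defs.
From Stdlib Require Import Arith.
From Stdlib Require Import Lia Classical ClassicalDescription.

(** Every axiom is true at every world of a model whose relations satisfy the
    conditions.  The delicate axiom is [ax_klmn_double]: since [k <= m] and [l <= n], the conclusion of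
    (cun^{k,l,m,n}) for [A, B] is again an instance of its premise, for
    [¬^(m-k) A, ¬^(n-l) B], so the condition can be applied twice; the truth
    value is preserved because [k], [l], [2m-k] and [2n-l] are all even. *)

Local Open Scope mbcl_scope.

Lemma negs_add (i j : nat) (A : form) : negs (i + j) A = negs i (negs j A).
Proof. apply Nat.iter_add. Qed.

(** Negations cancel in pairs, by double negation elimination in the metatheory. *)
Lemma truth_negs_even (F : frame) (v : valuation F) (w : world F)
    (j : nat) (A : form) :
  Nat.Even j -> truth F v w (negs j A) <-> truth F v w A.
Proof.
  intros [i ->]; induction i as [|i IH]; [reflexivity|].
  replace (2 * S i) with (2 + 2 * i) by lia.
  rewrite negs_add; cbn [negs Nat.iter nat_rect truth] in *.
  rewrite <- IH; split; [apply NNPP | tauto].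
Qed.

(** Links [Prop]-valued truth to Boolean tautologies: the informative excluded middle decides each
    [s p] at [w]. *)
Lemma truth_csubst (F : frame) (v : valuation F) (w : world F)
    (s : var -> form) (a : cform) :
  truth F v w (csubst s a) <->
  ceval (fun p => if excluded_middle_informative (truth F v w (s p))
                  then true else false) a = true.
Proof.
  induction a as [p|a IHa|a IHa b IHb|a IHa b IHb]; simpl.
  - destruct (excluded_middle_informative _); split; easy.
  - rewrite IHa; destruct (ceval _ a); simpl; split; congruence.
  - now rewrite IHa, IHb, Bool.andb_true_iff.
  - now rewrite IHa, IHb, Bool.orb_true_iff.
Qed.

Lemma cun_klmn_twice (k l m n : nat) (S : form -> form -> Prop) (A B : form) :
  k <= m -> l <= n -> rel_conditions k l m n S ->
  S (negs k A) (negs l B) -> S (negs (2 * m - k) A) (negs (2 * n - l) B).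
Proof.
  intros hkm hln HS H.
  apply (cond_cun_klmn _ _ _ _ _ HS) in H.
  replace (2 * m - k) with (m + (m - k)) by lia.
  replace (2 * n - l) with (n + (n - l)) by lia.
  rewrite !negs_add.
  apply (cond_cun_klmn _ _ _ _ _ HS); rewrite <- !negs_add.
  now replace (k + (m - k)) with m by lia; replace (l + (n - l)) with n by lia.
Qed.

Lemma even_double_sub (i j : nat) : Nat.Even i -> Nat.Even (2 * j - i).
(* [2 * j - 2 * h = 2 * (j - h)] survives truncation. *)
Proof. intros [h ->]; exists (j - h); lia. Qed.

Lemma truth_material (F : frame) (v : valuation F) (w : world F) (A B : form) :
  truth F v w (A ⊃ B) <-> (truth F v w A -> truth F v w B).
Proof. unfold material; simpl; split; [tauto | apply imply_to_or]. Qed.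

Lemma axiom_sound (k l m n : nat) (F : frame) (v : valuation F) (w : world F)
    (A : form) :
  k <= m -> l <= n -> Nat.Even k -> Nat.Even l ->
  frame_class k l m n F -> axiom k l m n A -> truth F v w A.
Proof.
  intros hkm hln hk hl HF HA; specialize (HF w).
  destruct HA as [a s Ha|A|A|A B|A B|A B|A B|A B|A B|A B|A|A B];
    rewrite ?truth_material.
  - apply truth_csubst, Ha.
  - intros [_ H]; exact (cond_a1 _ _ _ _ _ HF _ H).
  - intros [_ H]; exact (cond_a2 _ _ _ _ _ HF _ H).
  (* (b1) gives the relational half of the outer arrow; (b0) gives the material half, as [A] cannot
     be related to both [B] and [¬ B]. *)
  - split; [|apply (cond_b1 _ _ _ _ _ HF)].
    apply imply_to_or; intros [_ H1] [_ H2].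
    exact (cond_b0 _ _ _ _ _ HF _ _ H1 H2).
  - split; [|apply (cond_b2 _ _ _ _ _ HF)].
    apply imply_to_or; intros [_ H1] [_ H2].
    exact (cond_b0 _ _ _ _ _ HF _ _ H2 H1).
  - intros [H _]; tauto.
  - intros [_ H]; apply (cond_cun _ _ _ _ _ HF) in H; simpl.
    (* The material half of [¬ A ⇾ ¬ B] fails only when [A] is false and [B] true, which is the
       second disjunct. *)
    destruct (classic (truth F v w A)), (classic (truth F v w B)); tauto.
  - intros [H1 H2]; split; [simpl; tauto|].
    now do 2 apply (cond_cun _ _ _ _ _ HF).
  - intros [_ H]; apply (cond_cun_klmn _ _ _ _ _ HF) in H.
    (* Exposes the outermost negation of [¬^(n + 1) B], so that the case split can be on [¬^n B]. *)
    rewrite (Nat.add_comm n 1), negs_add; cbn [truth].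
    change (negs 1 (negs n B)) with (¬ negs n B); cbn [truth].
    destruct (classic (truth F v w (negs m A))),
      (classic (truth F v w (negs n B))); tauto.
  - intros [H1 H2]; split; [|now apply cun_klmn_twice].
    rewrite truth_negs_even in H1 |- * by auto using even_double_sub.
    now rewrite truth_negs_even in H1 |- * by auto using even_double_sub.
  - unfold equiv; simpl; split; apply imply_to_or.
    + intros [u [Hu HA]] H; exact (H u Hu HA).
    + intros H; apply NNPP; intros HA.
      apply H; intros u Hu HuA; apply HA; now exists u.
  - intros HAB HA u Hu; specialize (HAB u Hu).
    rewrite truth_material in HAB; exact (HAB (HA u Hu)).
Qed.

(** The world stays universally quantified in the induction, since necessitation moves to
    successors. *)
Lemma thm_sound (k l m n : nat) (F : frame) (v : valuation F) (A : form) :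
  k <= m -> l <= n -> Nat.Even k -> Nat.Even l ->
  frame_class k l m n F -> thm k l m n A -> forall w, truth F v w A.
Proof.
  intros hkm hln hk hl HF HA.
  induction HA as [A HA|A B _ IHA _ IHAB|A _ IHA]; intros w.
  - now apply (axiom_sound k l m n).
  - apply (proj1 (truth_material F v w A B)); auto.
  - intros u _; apply IHA.
Qed.

Theorem mainTheorem8 (k l m n : nat) (hkm : k <= m) (hln : l <= n)
    (hk : Nat.Even k) (hl : Nat.Even l) (Gamma : form -> Prop) (A : form) :
  derives k l m n Gamma A -> entails k l m n Gamma A.
Proof.
  intros HA F v w HF HGamma.
  (* Here [w] can stay fixed: necessitation occurs only inside [thm]. *)
  induction HA as [A HA|A HA|A B _ IHA _ IHAB].
  - now apply (thm_sound k l m n).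
  - now apply HGamma.
  - now apply (proj1 (truth_material F v w A B)).
Qed.
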